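(* Let $-\infty<a<b<\infty$, and for $\alpha\in(0,1)$ let ${}^{CF}_{\;\;a}D^{\alpha}$ denote the fractional Caputo--Fabrizio derivative of order $\alpha$. The following limits hold. a) If $f\in W^{1,1}(a,b)$, then $$\lim_{\alpha\nearrow 1}{}^{CF}_{\;\;a}D^{\alpha}f(t)=\frac{\mathrm{d}}{\mathrm{d}t}f(t)\qquad\text{a.e. in } (a,b).$$ b) If $f\in C^2[a,b]$, then $$\lim_{\alpha\nearrow 1}{}^{CF}_{\;\;a}D^{\alpha}f(t)=\frac{\mathrm{d}}{\mathrm{d}t}f(t)\qquad\text{for every } t\in(a,b].$$
   Context: $W^{1,1}(a,b)$ is the space of functions $f\in L^1(a,b)$ for which there exists $g\in L^1(a,b)$ with $\int_a^b f\varphi'=-\int_a^b g\varphi$ for all $\varphi\in C^1_c(a,b)$; this $g$ is the weak derivative $f'=\frac{\mathrm{d}}{\mathrm{d}t}f$. For $\alpha\in(0,1)$ and $f\in W^{1,1}(a,b)$, the fractional Caputo--Fabrizio derivative of order $\alpha$ is $${}^{CF}_{\;\;a}D^{\alpha}f(t)=\frac{1}{1-\alpha}\int_a^t f'(\tau)\,e^{-\frac{\alpha}{1-\alpha}(t-\tau)}\,\mathrm{d}\tau .$$ *)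

(* Defs.v *)
From mathcomp Require Export all_boot all_order all_algebra.
From mathcomp Require Export all_classical all_reals all_analysis.
Set Implicit Arguments.
Unset Strict Implicit.
Unset Printing Implicit Defensive.
Export Order.TTheory GRing.Theory Num.Theory.
Export numFieldNormedType.Exports.
Local Open Scope classical_set_scope.
Local Open Scope ring_scope.

Section caputo_fabrizio.
Context {R : realType}.
Implicit Types (a b t alpha : R) (f g phi : R -> R) (A : set R).
Let mu := @lebesgue_measure R.

(* C^1_c(a, b), with the elements extended by zero to the whole line. *)
Definition test_function a b phi : Prop :=
  [/\ forall t, derivable phi t 1, continuous (derive1 phi),
      compact (closure [set t | phi t != 0])
    & closure [set t | phi t != 0] `<=` `]a, b[].

Definition is_weak_derivative a b f g : Prop :=
  mu.-integrable `]a, b[ (EFin \o g) /\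
  forall phi, test_function a b phi ->
    \int[mu]_(t in `]a, b[) (f t * derive1 phi t) =
    - \int[mu]_(t in `]a, b[) (g t * phi t).

(* The values of f outside ]a, b[ are irrelevant. *)
Definition W11 a b f : Prop :=
  mu.-integrable `]a, b[ (EFin \o f) /\ exists g, is_weak_derivative a b f g.

(* A representative, fixed by choice, of the weak derivative; the latter is
   unique up to null subsets of ]a, b[. The default value 0 is used only when
   there is no weak derivative. *)
Definition weak_derivative a b f : R -> R :=
  xget (cst 0) [set g | is_weak_derivative a b f g].

(* Does not depend on the representative chosen for the weak derivative. *)
Definition caputo_fabrizio a b alpha f t : R :=
  (1 - alpha)^-1 *
  \int[mu]_(tau in `]a, t[)
    (weak_derivative a b f tau * expR (- (alpha / (1 - alpha)) * (t - tau))).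

(* Differentiation relative to A: only the values of f on A matter, so that on
   `[a, b] the derivatives at a and b are the one-sided ones. *)
Definition diff_quotient f t : R -> R := fun x => (f x - f t) / (x - t).

Definition derivable_on A f : Prop :=
  forall t, A t -> cvg (diff_quotient f t x @[x --> within A t^']).

Definition derive_on A f : R -> R :=
  fun t => lim (diff_quotient f t x @[x --> within A t^']).

Fixpoint Ck_on (k : nat) A f : Prop :=
  if k is k'.+1 then derivable_on A f /\ Ck_on k' A (derive_on A f)
  else {within A, continuous f}.

End caputo_fabrizio.

(* Main.v *)
Require Import Defs.
From mathcomp Require Import measurable_realfun ring lra.
Local Open Scope classical_set_scope.
Local Open Scope ring_scope.

(** With [k = alpha / (1 - alpha)] one has [(1 - alpha)^-1 = alpha^-1 * k], so
the Caputo-Fabrizio derivative at [t] is [alpha^-1] times the integral of the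
weak derivative against [k * exp (- k * (t - x))] over [a < x < t]. As [alpha]
increases to 1, [k] tends to infinity, and this kernel has total mass tending
to 1 and concentrates at the left of [t]: it is a one-sided approximate
identity.

The heart of the proof is [Rintegral_exp_kernel_cvg]: such averages of an
integrable function [h] converge to [c] as soon as the mean of [`|h - c|] over
[[t - r, t[] tends to 0 with [r]. For the part near [t]
([Rintegral_exp_kernel_blocks]), cut [[t - n / k, t[] into blocks of length
[1 / k]. On the [j]-th block the kernel is at most [k * 2 ^- j], and the
integral of [`|h - c|] over it is at most [e * (j + 1) / k], so the blocks
contribute at most [e] times the sum of the [(j + 1) / 2 ^ j], which is 4. The
part far from [t] is exponentially small in [k].

For a function of W^{1,1}, the Lebesgue differentiation theorem provides the
hypothesis at almost every [t], with [c] the value at [t] of the representative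
fixed for the weak derivative.

For a function [f] of class C^2, the classical derivative is continuous, so it
satisfies the hypothesis at every [t] of [`]a, b]]. It remains to pass from it
to the representative fixed for the weak derivative. The classical derivative
is a weak derivative, by integration by parts
([derive_on_is_weak_derivative]), and two weak derivatives of the same function
have the same integrals against a C^1 function over [`]a, t[]
([is_weak_derivative_integral_eq]): multiply this function by C^1 cutoffs with
compact support in [`]a, t[] that increase to 1, and apply dominated
convergence. Hence the two have the same averages against the kernel, for every
[t] and every [k]. *)

Set Implicit Arguments.
Unset Strict Implicit.
Unset Printing Implicit Defensive.

Section caputo_fabrizio_limit.
Context {R : realType}.
Local Notation mu := (@lebesgue_measure R).

(** * Functions of class C^1 on the line *)

Definition C1 (f : R -> R) : Prop :=
  (forall t, derivable f t 1) /\ continuous (derive1 f).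

Lemma C1_continuous (f : R -> R) : C1 f -> continuous f.
Proof.
by move=> [df _] x; apply: differentiable_continuous; apply/derivable1_diffP.
Qed.

Lemma C1M (f g : R -> R) : C1 f -> C1 g -> C1 (fun x => f x * g x).
Proof.
move=> Cf Cg; have [[df cf] [dg cg]] := (Cf, Cg); split.
  by move=> t; exact: derivableM.
have -> : derive1 (fun x => f x * g x) =
    (fun x => f x * derive1 g x + g x * derive1 f x).
  by apply/funext => x; rewrite !derive1E deriveM.
have [ctf ctg] := (C1_continuous Cf, C1_continuous Cg).
move=> x; apply: cvgD.
  by apply: cvgM; [exact: ctf|exact: cg].
by apply: cvgM; [exact: ctg|exact: cf].
Qed.

Lemma C1_comp (f g : R -> R) : C1 f -> C1 g -> C1 (f \o g).
Proof.
move=> Cf Cg; have [[df cf] [dg cg]] := (Cf, Cg).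
have d x := is_derive1_comp (derivableP (df (g x))) (derivableP (dg x)).
split; first by move=> t; have [] := d t.
have -> : derive1 (f \o g) = (fun x => derive1 f (g x) * derive1 g x).
  by apply/funext => x; have [_] := d x; rewrite !derive1E.
move=> x; apply: cvgM; last exact: cg.
by apply: continuous_comp; [exact: C1_continuous|exact: cf].
Qed.

(** * Cutoff functions *)

(** The derivative [2 * max y 0] is 2-Lipschitz, so the error in the first-order
expansion at [y] is at most the square of the increment. This avoids separating
the cases [y < 0], [y = 0] and [y > 0]. *)
Lemma is_derive_sqr_max0 (y : R) :
  is_derive y 1 (fun y => Num.max y 0 ^+ 2) (2 * Num.max y 0).
Proof.
suff h : (fun h => h^-1 *: (Num.max (h *: 1 + y) 0 ^+ 2 - Num.max y 0 ^+ 2))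
    @ 0^' --> 2 * Num.max y 0.
  by apply: DeriveDef; [apply/cvg_ex; exists (2 * Num.max y 0)|exact: cvg_lim].
apply/cvgrPdist_le => e e0; near=> h.
have h0 : h != 0 by near: h; exact: nbhs_dnbhs_neq.
have he : `|h| <= e.
  near: h; apply/nbhs_dnbhs; near=> h.
  by near: h; apply/(@nbhs0_le _ R^o).
rewrite (le_trans _ he)// /GRing.scale/= mulr1.
have key : `|2 * Num.max y 0 * h - (Num.max (h + y) 0 ^+ 2 - Num.max y 0 ^+ 2)|
    <= `|h| * `|h|.
  have -> : `|h| * `|h| = h ^+ 2 by rewrite -normrM -expr2 ger0_norm// sqr_ge0.
  rewrite ler_norml.
  by case: (lerP y 0) => ?; case: (lerP (h + y) 0) => ?; apply/andP; split; nra.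
have -> : 2 * Num.max y 0 - h^-1 * (Num.max (h + y) 0 ^+ 2 - Num.max y 0 ^+ 2)
    = h^-1 * (2 * Num.max y 0 * h - (Num.max (h + y) 0 ^+ 2 - Num.max y 0 ^+ 2)).
  by field.
by rewrite normrM normfV ler_pdivrMl ?normr_gt0.
Unshelve. all: by end_near. Qed.

Lemma continuous_max0 : continuous (fun y : R => Num.max y 0).
Proof. move=> y; apply: continuous_max; [exact: cvg_id|exact: cvg_cst]. Qed.

(** A C^1 function that vanishes on the nonpositive half-line and tends to 1 at
infinity: it is [y ^+ 2 / (1 + y ^+ 2)] for [0 <= y]. Squaring [max y 0] is what
makes the junction at 0 differentiable. *)
Definition ramp (y : R) : R := 1 - (1 + Num.max y 0 ^+ 2)^-1.

Lemma ramp_le0 (y : R) : y <= 0 -> ramp y = 0.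
Proof. by move=> y0; rewrite /ramp max_r// expr0n/= addr0 invr1 subrr. Qed.

Lemma ramp_itv (y : R) : 0 <= ramp y <= 1.
Proof.
have h : 0 < 1 + Num.max y 0 ^+ 2 by rewrite ltr_pwDl// sqr_ge0.
rewrite /ramp subr_ge0 invf_le1// lerDl sqr_ge0/=.
by rewrite lerBlDr lerDl invr_ge0 ltW.
Qed.

Lemma is_derive_ramp (y : R) :
  is_derive y 1 ramp (2 * Num.max y 0 / (1 + Num.max y 0 ^+ 2) ^+ 2).
Proof.
have h : 0 < 1 + Num.max y 0 ^+ 2 by rewrite ltr_pwDl// sqr_ge0.
have dq := is_derive_sqr_max0 y.
have d1 : is_derive y 1 (fun y : R => 1 + Num.max y 0 ^+ 2) (2 * Num.max y 0).
  by have := is_deriveD (is_derive_cst (1 : R) y 1) dq; rewrite add0r.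
have d2 := @is_deriveV R (fun y => 1 + Num.max y 0 ^+ 2) y _ 1 (lt0r_neq0 h) d1.
have : is_derive y 1 (fun y : R => 1 - (1 + Num.max y 0 ^+ 2)^-1)
  (0 - (- (1 + Num.max y 0 ^+ 2) ^- 2 *: (2 * Num.max y 0))).
  exact: (is_deriveB (is_derive_cst (1 : R) y 1) d2).
by rewrite sub0r scaleNr opprK /GRing.scale/= mulrC.
Qed.

Lemma cvg_ramp : ramp (y : R) @[y --> +oo] --> (1 : R).
Proof.
rewrite -[X in _ --> X]subr0; apply: cvgB; first exact: cvg_cst.
have hp : \forall y \near +oo, 0 < 1 + Num.max (y : R) 0 ^+ 2.
  by apply: nearW => y; rewrite ltr_pwDl// sqr_ge0.
apply/(gtr0_cvgV0 hp).
apply/cvgryPge => A; near=> y.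
have y1 : 1 <= y by near: y; apply: nbhs_pinfty_ge; exact: num_real.
have yA : A <= y by near: y; apply: nbhs_pinfty_ge; exact: num_real.
rewrite max_l ?(le_trans ler01)//.
by rewrite (le_trans yA)// expr2; nra.
Unshelve. all: by end_near. Qed.

Lemma C1_ramp : C1 ramp.
Proof.
split=> [t|]; first by have [] := is_derive_ramp t.
have -> : derive1 ramp =
    (fun y => 2 * Num.max y 0 / (1 + Num.max y 0 ^+ 2) ^+ 2).
  by apply/funext => y; rewrite derive1E; have [_ ->] := is_derive_ramp y.
move=> y; have cm := @continuous_max0 y; apply: cvgM.
  by apply: cvgM => //; exact: cvg_cst.
apply: cvgV; first by rewrite sqrf_eq0 gt_eqF// ltr_pwDl// sqr_ge0.
have c1 : (1 + Num.max x 0 * Num.max x 0) @[x --> y] -->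
    1 + Num.max y 0 * Num.max y 0.
  by apply: cvgD; [exact: cvg_cst|exact: cvgM].
by rewrite !expr2; exact: cvgM.
Qed.

Lemma C1_parabola (k a t : R) :
  C1 (fun x => k * ((x - a) * (t - x)) - 1).
Proof.
have d (x : R) : is_derive x 1 (fun x : R => k * ((x - a) * (t - x)) - 1)
    (k * (a + t - 2 * x)).
  by apply: is_derive_eq; rewrite /GRing.scale/=; ring.
split=> [x|]; first by have [] := d x.
have -> : derive1 (fun x => k * ((x - a) * (t - x)) - 1) =
    (fun x => k * (a + t - 2 * x)).
  by apply/funext => x; rewrite derive1E; have [_ ->] := d x.
move=> x; apply: cvgM; first exact: cvg_cst.
apply: cvgB; first exact: cvg_cst.
by apply: cvgM; [exact: cvg_cst|exact: cvg_id].
Qed.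

(** For [a < t] the parabola [(x - a) * (t - x)] is positive exactly on
[`]a, t[]. Subtracting 1 after the scaling keeps the support at a positive distance from [a] and
[t], for every [n]. *)
Definition cutoff (a t : R) (n : nat) (x : R) : R :=
  ramp (n.+1%:R * ((x - a) * (t - x)) - 1).

Lemma cvg_cutoff (a t x : R) : a < t ->
  cutoff a t n x @[n --> \oo] --> ((x \in `]a, t[)%:R : R).
Proof.
move=> at_; have [xat|xat] := boolP (x \in `]a, t[).
  have c0 : 0 < (x - a) * (t - x) by rewrite mulr_gt0 ?subr_gt0 ?(itvP xat).
  apply: (cvg_comp _ _ _ cvg_ramp).
  apply/cvgryPge => A; near=> n.
  rewrite lerBrDr -ler_pdivrMr//; apply: (@le_trans _ _ n%:R).
    by near: n; apply: nbhs_infty_ger; exact: num_real.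
  by rewrite ler_nat.
have -> : cutoff a t ^~ x = cst 0; last exact: cvg_cst.
apply/funext => n; apply: ramp_le0; rewrite subr_le0.
rewrite (@le_trans _ _ 0)// mulr_ge0_le0//.
by move: xat; rewrite in_itv/= negb_and -!leNgt => /orP[h|h]; nra.
Unshelve. all: by end_near. Qed.

(** The support lies in the closed set where the scaled parabola is at least 1,
which is contained in [`]a, t[]. *)
Lemma cutoff_test_function (a b t : R) (n : nat) (psi : R -> R) :
  a < t <= b -> C1 psi -> test_function a b (fun x => cutoff a t n x * psi x).
Proof.
move=> /andP[at_ tb] Cpsi.
have Cc : C1 (cutoff a t n) by apply: (C1_comp C1_ramp (C1_parabola _ a t)).
have [dphi cphi] := C1M Cc Cpsi.
pose K := [set x | 0 <= n.+1%:R * ((x - a) * (t - x)) - 1].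
have cK : closed K.
  apply: (@preimage_closed _ _ (fun x => n.+1%:R * ((x - a) * (t - x)) - 1)
    [set y | 0 <= y]).
    by move=> x _; exact: C1_continuous (C1_parabola _ a t) x.
  exact: closed_ge.
have suppK : closure [set x | cutoff a t n x * psi x != 0] `<=` K.
  rewrite (closure_id K).1//; apply: closureS => x /=; rewrite /K/=.
  rewrite leNgt; apply: contra => /ltW/ramp_le0; rewrite /cutoff => ->.
  by rewrite mul0r.
have Kat : K `<=` `]a, t[.
  move=> x; rewrite /K/= in_itv/= => h.
  have n0 : 0 < n.+1%:R :> R by [].
  have {h} : 0 < (x - a) * (t - x) by nra.
  by move=> h; apply/andP; split; rewrite ltNge; apply/negP => ?; nra.
split => //.
- apply: (@subclosed_compact _ _ `[a, t]); first exact: closed_closure.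
    exact: segment_compact.
  by move=> x /suppK/Kat; exact: subset_itv_oo_cc.
- move=> x /suppK/Kat; apply: subset_itvl; by rewrite bnd_simp.
Qed.

(** * Weak derivatives tested on an interval *)

(** Dominated convergence: [cutoff a t n] is bounded by 1 and tends to the
indicator of [`]a, t[]. *)
Lemma cvg_integral_cutoff (a b t : R) (g psi : R -> R) :
  a < t <= b -> mu.-integrable `]a, b[ (EFin \o g) -> C1 psi ->
  \int[mu]_(x in `]a, b[) (g x * (cutoff a t n x * psi x))
    @[n --> \oo] --> \int[mu]_(x in `]a, t[) (g x * psi x).
Proof.
move=> /andP[at_ tb] ig Cpsi.
have cpsi := C1_continuous Cpsi.
have [M Mpsi] : exists M, forall x, x \in `]a, b[ -> `|psi x| <= M.
  have /compact_bounded[M [_ hM]] :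
      compact (psi @` `[a, b]).
    apply: continuous_compact; last exact: segment_compact.
    exact: continuous_subspaceT.
  exists (M + 1) => x xab; apply: (hM (M + 1)); first by rewrite ltrDl.
  by exists x => //; exact: subset_itv_oo_cc.
have mg : measurable_fun `]a, b[ g.
  by apply/measurable_EFinP; exact: measurable_int ig.
have mpsi : measurable_fun `]a, b[ psi.
  apply: (@measurable_funS _ _ _ _ setT) => //.
  exact: continuous_measurable_fun.
have mc n : measurable_fun `]a, b[ (cutoff a t n).
  apply: (@measurable_funS _ _ _ _ setT) => //.
  apply: continuous_measurable_fun; apply: C1_continuous.
  exact: (C1_comp C1_ramp (C1_parabola _ a t)).
pose f_ n x := (g x * (cutoff a t n x * psi x))%:E.
pose f x := (g x * ((x \in `]a, t[)%:R * psi x))%:E.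
have fE : \int[mu]_(x in `]a, t[) (g x * psi x) =
    fine (\int[mu]_(x in `]a, b[) f x)%E.
  have -> : `]a, t[%classic = `]a, b[ `&` `]a, t[ :> set R.
    rewrite setIidr//; apply: subset_itvl; by rewrite bnd_simp.
  rewrite Rintegral_mkcondr; congr fine; apply: eq_integral => x _ /=.
  rewrite /f patchE mem_setE; case: ifP => _; first by rewrite mul1r.
  by rewrite mul0r mulr0.
rewrite fE; apply: fine_cvg.
have f_f x : f_ n x @[n --> \oo] --> f x.
  apply: cvg_EFin; first exact: nearW.
  apply: cvgM; first exact: cvg_cst.
  by apply: cvgM; [exact: cvg_cutoff|exact: cvg_cst].
have mf_ n : measurable_fun `]a, b[ (f_ n).
  apply/measurable_EFinP; apply: measurable_funM => //.
  exact: measurable_funM.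
have mf : measurable_fun `]a, b[ f.
  apply: (@emeasurable_fun_cvg _ _ _ _ f_) => // x _; exact: f_f.
have ibound : mu.-integrable `]a, b[ (fun x => (M * `|g x|)%:E).
  rewrite (_ : (fun x => _) = (fun x => M%:E * `|(EFin \o g) x|)%E)//.
  by apply: integrableZl => //; exact: integrable_abse.
have [||if_ _] := @dominated_convergence _ (measurableTypeR R) R mu
  `]a, b[%classic (measurable_itv _) _ _ _ mf_ mf _ ibound _.
- by apply: aeW => x _; exact: f_f.
- apply: aeW => x n xab; rewrite /f_ /= lee_fin !normrM mulrC ler_wpM2r//.
  have /andP[c0 c1] := ramp_itv (n.+1%:R * ((x - a) * (t - x)) - 1).
  by rewrite (le_trans _ (Mpsi x xab))// ger0_norm// ler_piMl.
- by rewrite fineK//; exact: integrable_fin_num.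
Qed.

(** The integrals of [g1] and of [g2] against the test function
[cutoff a t n * psi] both equal the opposite of the integral of [f] against its
derivative; let [n] tend to infinity. The case [t = b] is included although
[psi] need not vanish at [b]. *)
Lemma is_weak_derivative_integral_eq (a b t : R)
    (f g1 g2 psi : R -> R) :
  a < t <= b -> is_weak_derivative a b f g1 -> is_weak_derivative a b f g2 ->
  C1 psi ->
  \int[mu]_(x in `]a, t[) (g1 x * psi x) =
  \int[mu]_(x in `]a, t[) (g2 x * psi x).
Proof.
move=> atb [ig1 w1] [ig2 w2] Cpsi.
have h1 := cvg_integral_cutoff atb ig1 Cpsi.
have h2 := cvg_integral_cutoff atb ig2 Cpsi.
have e n : \int[mu]_(x in `]a, b[) (g1 x * (cutoff a t n x * psi x))
  = \int[mu]_(x in `]a, b[) (g2 x * (cutoff a t n x * psi x)).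
  have tf := cutoff_test_function n atb Cpsi.
  by apply: oppr_inj; rewrite -w2// -w1.
by move: h1; rewrite (funext e) => h1; exact: (cvg_unique _ h1 h2).
Qed.

Lemma weak_derivativeP (a b : R) (f g : R -> R) :
  is_weak_derivative a b f g -> is_weak_derivative a b f (weak_derivative a b f).
Proof. by move=> fg; apply: (xgetPex (cst 0)); exists g. Qed.

(** * Classical derivatives as weak derivatives *)

(** The limit defining [derive_on], with the punctured relative neighbourhood
spelled out. *)
Lemma derive_onP (A : set R) (f : R -> R) t :
  derivable_on A f -> A t -> forall e, 0 < e ->
  \forall x \near t, A x -> x != t ->
    `|derive_on A f t - diff_quotient f t x| <= e.
Proof.
move=> df At e e0; have /cvgrPdist_le/(_ e e0) := df t At.
rewrite !near_withinE; apply: filterS => x h Ax xt; exact: h.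
Qed.

Lemma derivable_on_continuous (A : set R) (f : R -> R) :
  derivable_on A f -> {within A, continuous f}.
Proof.
move=> df; apply/subspace_continuousP => t At.
have h := derive_onP df At ltr01; set l := derive_on A f t in h.
apply/cvgrPdist_le => e e0; rewrite near_withinE.
near=> x => Ax; have [->|xt] := eqVneq x t; first by rewrite subrr normr0 ltW.
have xt0 : x - t != 0 by rewrite subr_eq0.
have dq : `|diff_quotient f t x| <= `|l| + 1.
  have hx : `|l - diff_quotient f t x| <= 1 by move: Ax xt; near: x.
  rewrite -(subKr l (diff_quotient f t x)) (le_trans (ler_normB _ _))//.
  by rewrite lerD2l.
suff -> : from_subspace A f t - from_subspace A f x =
    - (diff_quotient f t x * (x - t)).
  rewrite normrN normrM (le_trans (ler_wpM2r _ dq))//.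
  rewrite mulrC -ler_pdivlMr ?ltr_wpDl//.
  near: x; apply: (@cvgr_distC_le _ _ _ _ _ id); first exact: cvg_id.
  by rewrite divr_gt0// ltr_wpDl.
by rewrite /diff_quotient divfK// opprB.
Unshelve. all: by end_near. Qed.

Lemma derive_on_interior (a b t : R) (f : R -> R) :
  derivable_on `[a, b] f -> t \in `]a, b[ ->
  is_derive t 1 f (derive_on `[a, b] f t).
Proof.
move=> df tab; set l := derive_on _ _ _.
suff h : (fun h => h^-1 *: (f (h *: 1 + t) - f t)) @ 0^' --> l.
  by apply: DeriveDef; [apply/cvg_ex; exists l|exact: cvg_lim].
apply/cvgrPdist_le => e e0.
have hd := derive_onP df (subset_itv_oo_cc tab) e0.
have hab : \forall x \near t, `[a, b]%classic x.
  by apply: filterS (near_in_itvoo tab) => x; exact: subset_itv_oo_cc.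
have [d /= d0 hh] : nbhs t (fun x => x != t -> `|l - diff_quotient f t x| <= e).
  by apply: filterS2 hd hab => x h1 h2; exact: h1.
rewrite near_withinE; exists d => // h; rewrite /ball/= sub0r normrN => hd' h0.
rewrite /GRing.scale/= mulr1.
have := hh (h + t); rewrite /ball/= opprD addrCA subrr addr0 normrN => /(_ hd').
rewrite /diff_quotient addrK mulrC; apply.
by rewrite -subr_eq0 addrK.
Qed.

(** A test function vanishes at [a] and [b], its support being contained in the
open interval, so integration by parts leaves no boundary term. *)
Lemma derive_on_is_weak_derivative (a b : R) (f : R -> R) :
  a < b -> Ck_on 1 `[a, b] f -> is_weak_derivative a b f (derive_on `[a, b] f).
Proof.
move=> ab [df /= cdf]; have cf := derivable_on_continuous df.
have cpt : compact `[a, b] by exact: segment_compact.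
have icc g : {within `[a, b], continuous g} ->
    mu.-integrable `[a, b] (EFin \o g).
  exact: continuous_compact_integrable.
have ioo g : {within `[a, b], continuous g} ->
    mu.-integrable `]a, b[ (EFin \o g).
  move=> cg; apply: integrableS (icc _ cg) => //; exact: subset_itv_oo_cc.
have Ioo g : {within `[a, b], continuous g} ->
    \int[mu]_(x in `]a, b[) g x =
    \int[mu]_(x in `[a, b]) g x.
  move=> cg; rewrite Rintegral_itv_bndo_bndc; last exact: ioo.
  rewrite Rintegral_itv_obnd_cbnd//.
  by apply: integrableS (icc _ cg) => //; exact: subset_itv_oc_cc.
split; first exact: ioo.
move=> phi [dphi cphi _ suppphi].
have ctphi : continuous phi by apply: C1_continuous.
have phi0 x : ~~ (x \in `]a, b[) -> phi x = 0.
  move=> xab; apply: contraNeq xab => px; apply: suppphi; exact: subset_closure.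
have cM (g h : R -> R) : {within `[a, b], continuous g} -> continuous h ->
    {within `[a, b], continuous (fun x => g x * h x)}.
  move=> cg ch x; apply: cvgM; first exact: cg.
  exact: (continuous_subspaceT ch).
rewrite !Ioo; [|exact: cM..].
rewrite (@Rintegration_by_parts _ f phi (derive_on `[a, b] f) (derive1 phi))//.
- rewrite !phi0 ?in_itv/= ?ltxx ?andbF//; by rewrite !mulr0 subrr sub0r.
- have [_ fa fb] := (continuous_within_itvP f ab).1 cf.
  by split=> // x xab; have [] := derive_on_interior df xab.
- by move=> x xab; rewrite derive1E; have [_ ->] := derive_on_interior df xab.
- exact: continuous_subspaceT.
- split=> [x _||]; [exact: dphi| |].
  + by apply: cvg_at_right_filter; exact: ctphi.
  + by apply: cvg_at_left_filter; exact: ctphi.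
Qed.

(** * The exponential kernel *)

Definition exp_kernel (k t x : R) : R := expR (- k * (t - x)).

Lemma is_derive_exp_kernel (k t x : R) :
  is_derive x 1 (exp_kernel k t) (k * exp_kernel k t x).
Proof.
have d : is_derive x 1 (fun x : R => - k * (t - x)) k.
  by apply: is_derive_eq; rewrite /GRing.scale/=; ring.
have := @is_derive1_comp R expR (fun x => - k * (t - x)) x _ _
  (is_derive_expR _) d.
by rewrite mulrC.
Qed.

Lemma C1_exp_kernel (k t : R) : C1 (exp_kernel k t).
Proof.
have dE (x : R) := is_derive_exp_kernel k t x.
have cE : continuous (exp_kernel k t).
  move=> x; apply: differentiable_continuous; apply/derivable1_diffP.
  by have [] := dE x.
split=> [x|]; first by have [] := dE x.
have -> : derive1 (exp_kernel k t) = (fun x => k * exp_kernel k t x).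
  by apply/funext => x; rewrite derive1E; have [_ ->] := dE x.
move=> x; apply: cvgM; [exact: cvg_cst|exact: cE].
Qed.

Lemma Rintegral_exp_kernel (k a t : R) : a < t ->
  \int[mu]_(x in `]a, t[) (k * exp_kernel k t x) =
  1 - expR (- k * (t - a)).
Proof.
move=> at_; have [dE cE'] := C1_exp_kernel k t.
have cE := C1_continuous (C1_exp_kernel k t).
have ckE : continuous (fun x => k * exp_kernel k t x).
  by move=> x; apply: cvgM; [exact: cvg_cst|exact: cE].
have icc : mu.-integrable `[a, t]
    (EFin \o (fun x => k * exp_kernel k t x)).
  apply: continuous_compact_integrable; first exact: segment_compact.
  exact: continuous_subspaceT.
rewrite Rintegral_itv_bndo_bndc; last first.
  by apply: integrableS icc => //; exact: subset_itv_oo_cc.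
rewrite Rintegral_itv_obnd_cbnd; last first.
  by apply: integrableS icc => //; exact: subset_itv_oc_cc.
rewrite /Rintegral (@continuous_FTC2 _ _ (exp_kernel k t))//.
- by rewrite /= /exp_kernel subrr mulr0 expR0.
- exact: continuous_subspaceT.
- split=> [x _||]; [exact: dE| |].
  + by apply: cvg_at_right_filter; exact: cE.
  + by apply: cvg_at_left_filter; exact: cE.
- move=> x _; rewrite derive1E; by have [_ ->] := is_derive_exp_kernel k t x.
Qed.

Lemma exp_kernel_ge0 (k t x : R) : 0 <= exp_kernel k t x.
Proof. exact: expR_ge0. Qed.

Lemma exp_kernel_le (k t s x : R) :
  0 <= k -> x <= s -> exp_kernel k t x <= expR (- k * (t - s)).
Proof. by move=> k0 xs; rewrite ler_expR !mulNr lerN2 ler_wpM2l// lerB. Qed.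

Lemma integrableM_exp_kernel (D : set R) (k t : R) (h : R -> R) :
  @measurable _ (measurableTypeR R) D -> 0 <= k -> D `<=` [set x | x <= t] ->
  mu.-integrable D (EFin \o h) ->
  mu.-integrable D (EFin \o (fun x => h x * exp_kernel k t x)).
Proof.
move=> mD k0 Dt ih.
apply: (le_integrable mD _ _ ih).
  apply/measurable_EFinP; apply: measurable_funM.
    by apply/measurable_EFinP; exact: measurable_int ih.
  apply: (@measurable_funS _ _ _ _ setT) => //.
  apply: continuous_measurable_fun; exact: C1_continuous (C1_exp_kernel k t).
move=> x Dx; rewrite /= lee_fin normrM ler_piMr// ger0_norm ?exp_kernel_ge0//.
rewrite (le_trans (exp_kernel_le t k0 (Dt x Dx)))//.
by rewrite subrr mulr0 expR0.
Qed.

Lemma Rintegral_itv_cat (i : itv_bound R) (s t : R) (f : R -> R) :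
  (i <= BLeft s)%O -> s <= t ->
  mu.-integrable [set` Interval i (BLeft t)] (EFin \o f) ->
  \int[mu]_(x in [set` Interval i (BLeft t)]) f x =
  \int[mu]_(x in [set` Interval i (BLeft s)]) f x +
  \int[mu]_(x in `[s, t[) f x.
Proof.
move=> is_ st; have e := @itv_bndbnd_setU _ _ i (BLeft s) (BLeft t) is_ st.
rewrite e => if_; rewrite Rintegral_setU//.
apply/disj_setPS => y [/=]; rewrite !in_itv/= => /andP[_ ys] /andP[].
by rewrite leNgt ys.
Qed.

(** The inductive step of [Rintegral_exp_kernel_blocks], with [q] for [2 ^- m]:
the partial sums of [(j + 1) / 2 ^ j] over [j < m] are
[4 - (2 * m + 4) / 2 ^ m]. *)
Lemma weights_telescope (e k q m : R) :
  e * ((m + 1) / k) * q + e / k * (4 - (2 * m + 4) * q) =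
  e / k * (4 - (2 * (m + 1) + 4) * (2^-1 * q)).
Proof. by move: k^-1 => j; field. Qed.

(** Induction on the number of blocks of length [1 / k]. On the block added at
step [n] the kernel is at most [exp (- n)], hence at most [2 ^- n], and the
integral of [h] over that block is at most its integral up to [t]. The exact
value of the partial sum of the weights is kept to let the induction go
through; only its bound 4 matters afterwards. *)
Lemma Rintegral_exp_kernel_blocks (k t e : R) (n : nat) (h : R -> R) :
  0 < k -> (forall x, 0 <= h x) ->
  mu.-integrable `[t - n%:R / k, t[ (EFin \o h) ->
  (forall m, (m <= n)%N ->
    \int[mu]_(x in `[t - m%:R / k, t[) h x <= e * (m%:R / k)) ->
  \int[mu]_(x in `[t - n%:R / k, t[) (h x * exp_kernel k t x) <=
    e / k * (4 - (2 * n%:R + 4) / 2 ^+ n).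
Proof.
move=> k0 h0; elim: n => [|n IH] ih He.
  rewrite mul0r subr0 set_itvco0 Rintegral_set0.
  by rewrite mulr0 add0r expr0 divr1 subrr mulr0.
set s := t - n.+1%:R / k in ih *; set s' := t - n%:R / k in IH *.
have ss' : s <= s' by rewrite lerB// ler_pM2r ?invr_gt0// ler_nat.
have s't : s' <= t by rewrite gerBl divr_ge0// ltW.
have le_t (u v : R) : `[u, v[%classic `<=` [set x : R | x <= v].
  by move=> x /=; rewrite in_itv/= => /andP[_ /ltW].
have ih' : mu.-integrable `[s', t[ (EFin \o h).
  by apply: integrableS ih => //; apply: subset_itvr; rewrite bnd_simp.
have ih'' : mu.-integrable `[s, s'[ (EFin \o h).
  by apply: integrableS ih => //; apply: subset_itvl; rewrite bnd_simp.
rewrite (@Rintegral_itv_cat (BLeft s) s' t)//; last first.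
  by apply: integrableM_exp_kernel => //; exact: ltW.
have {}IH := IH ih' (fun m mn => He m (leqW mn)).
have Hn := He n.+1 (leqnn _).
rewrite -/s (@Rintegral_itv_cat (BLeft s) s' t)// in Hn.
have I0 : 0 <= \int[mu]_(x in `[s', t[) h x.
  by apply: Rintegral_ge0 => x _.
(* The kernel is at most [exp (- n)] here, and [exp 1] is at least 2. *)
have block : \int[mu]_(x in `[s, s'[) (h x * exp_kernel k t x) <=
    \int[mu]_(x in `[s, s'[) h x * (2 ^+ n)^-1.
  rewrite -RintegralZr//; apply: le_Rintegral => //.
  - apply: integrableM_exp_kernel => //; first exact: ltW.
    by move=> x /le_t /= xs; rewrite (le_trans xs).
  - rewrite (_ : _ \o _ = fun x => (EFin \o h) x * ((2 ^+ n)^-1)%:E)%E//.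
    exact: integrableZr.
  - move=> x /le_t /= xs; rewrite ler_wpM2l//.
    rewrite (le_trans (exp_kernel_le t (ltW k0) xs))//.
    rewrite /s' opprB addrCA subrr addr0 mulNr mulrCA divff ?gt_eqF// mulr1.
    rewrite expRN lef_pV2 ?posrE ?exprn_gt0 ?expR_gt0// -[n%:R]mulr1 expRM_natl.
    by rewrite lerXn2r ?nnegrE// ?expR_ge0// (le_trans _ (expR_ge1Dx 1)).
rewrite (le_trans (lerD block IH))//.
have q0 : 0 < (2 ^+ n)^-1 :> R by rewrite invr_gt0 exprn_gt0.
have Hn' : \int[mu]_(x in `[s, s'[) h x <= e * (n.+1%:R / k).
  by rewrite (le_trans _ Hn)// lerDl.
rewrite (le_trans (lerD (ler_wpM2r (ltW q0) Hn') (lexx _)))//.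
by rewrite exprS invfM -natr1 weights_telescope.
Qed.

(** Split at [s = t - n / k], with [n] the integer part of [k * d]: the blocks
then fill as much of [[t - d, t[] as they can, and to the left of [s] the kernel
is at most [exp (- n)], which is at most [exp (1 - k * d)]. *)
Lemma Rintegral_exp_kernel_bound (k a t d e : R) (g : R -> R) :
  0 < k -> 0 < d < t - a -> (forall x, 0 <= g x) ->
  mu.-integrable `]a, t[ (EFin \o g) ->
  (forall r, 0 <= r <= d ->
    \int[mu]_(x in `[t - r, t[) g x <= e * r) ->
  k * \int[mu]_(x in `]a, t[) (g x * exp_kernel k t x) <=
  4 * e + k * expR (1 - k * d) * \int[mu]_(x in `]a, t[) g x.
Proof.
move=> k0 /andP[d0 dta] g0 ig He.
have kd0 : 0 <= k * d by rewrite mulr_ge0 ?ltW.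
have /andP[n1 n2] := truncn_itv kd0; set n := Num.truncn _ in n1 n2.
have nkd : n%:R / k <= d by rewrite ler_pdivrMr// mulrC.
have nk0 : 0 <= n%:R / k by rewrite divr_ge0// ltW.
set s := t - n%:R / k.
have as_ : a < s by rewrite /s ltrBrDr -ltrBrDl (le_lt_trans nkd).
have st : s <= t by rewrite gerBl.
(* The sign of [e] is forced by the hypothesis at [r = d]. *)
have e0 : 0 <= e.
  have I0 : 0 <= \int[mu]_(x in `[t - d, t[) g x.
    by apply: Rintegral_ge0 => x _.
  by rewrite -(@pmulr_lge0 _ d)// (le_trans I0)// He// lexx ltW.
have sub_t : `]a, t[%classic `<=` [set x : R | x <= t].
  by move=> x /=; rewrite in_itv/= => /andP[_ /ltW].
have sub_s : `]a, s[%classic `<=` [set x : R | x <= s].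
  by move=> x /=; rewrite in_itv/= => /andP[_ /ltW].
have ig1 : mu.-integrable `]a, s[ (EFin \o g).
  by apply: integrableS ig => //; apply: subset_itvl; rewrite bnd_simp.
have ig2 : mu.-integrable `[s, t[ (EFin \o g).
  by apply: integrableS ig => //; apply: subset_itvr; rewrite bnd_simp.
have igE := integrableM_exp_kernel (measurable_itv _) (ltW k0) sub_t ig.
rewrite (@Rintegral_itv_cat (BRight a) s t)// mulrDr addrC.
have near_part : k * \int[mu]_(x in `[s, t[) (g x * exp_kernel k t x)
    <= 4 * e.
  rewrite -ler_pdivlMl//.
  have Hm m : (m <= n)%N ->
      \int[mu]_(x in `[t - m%:R / k, t[) g x <= e * (m%:R / k).
    move=> mn; apply: He; rewrite divr_ge0 ?(ltW k0)//= (le_trans _ nkd)//.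
    by rewrite ler_pM2r ?invr_gt0// ler_nat.
  rewrite (le_trans (Rintegral_exp_kernel_blocks k0 g0 ig2 Hm))//.
  rewrite [leRHS]mulrCA [k^-1 * e]mulrC [leLHS]mulrC.
  rewrite ler_wpM2r ?divr_ge0 ?(ltW k0)//.
  by rewrite gerBl divr_ge0 ?exprn_ge0// addr_ge0// mulr_ge0.
have far_part : \int[mu]_(x in `]a, s[) (g x * exp_kernel k t x)
    <= expR (1 - k * d) * \int[mu]_(x in `]a, t[) g x.
  have far1 : \int[mu]_(x in `]a, s[) (g x * exp_kernel k t x)
      <= \int[mu]_(x in `]a, s[) (expR (1 - k * d) * g x).
    apply: le_Rintegral => //.
    - apply: integrableM_exp_kernel => //; first exact: ltW.
      by move=> x /sub_s /= xs; rewrite (le_trans xs).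
    - rewrite (_ : _ \o _ = fun x => (expR (1 - k * d))%:E * (EFin \o g) x)%E//.
      exact: integrableZl.
    - move=> x /sub_s /= xs; rewrite mulrC ler_wpM2r//.
      rewrite (le_trans (exp_kernel_le t (ltW k0) xs))//.
      rewrite ler_expR /s opprB addrCA subrr addr0 mulNr mulrCA divff ?gt_eqF//.
      by rewrite mulr1 lerNl opprB lerBlDr natr1 ltW.
  rewrite (le_trans far1)// RintegralZl// ler_wpM2l ?expR_ge0//.
  rewrite (@Rintegral_itv_cat (BRight a) s t)// lerDl.
  by apply: Rintegral_ge0 => x _.
by rewrite lerD// -mulrA ler_pM2l.
Qed.

(** The exponential dominates [(k * d) ^+ 2 / 2], so the left-hand side is
[O(1 / k)]. *)
Lemma near_expR_tail (B d A e : R) : 0 < d -> 0 <= A -> 0 < e ->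
  \forall k \near +oo, k * expR (B - k * d) * A <= e.
Proof.
move=> d0 A0 e0; near=> k.
have k0 : 0 < k by near: k; apply: nbhs_pinfty_gt; exact: num_real.
have kA : expR B * A * 2 / (e * d ^+ 2) <= k.
  by near: k; apply: nbhs_pinfty_ge; exact: num_real.
have kd0 : 0 <= k * d by rewrite mulr_ge0// ltW.
have sq : (k * d) ^+ 2 / 2 <= expR (k * d).
  by rewrite (le_trans _ (expR_ge1Dxn 1 kd0))// lerDr.
rewrite expRD expRN mulrA mulrAC ler_pdivrMr ?expR_gt0//.
rewrite (le_trans _ (ler_wpM2l (ltW e0) sq))//.
rewrite ler_pdivrMr ?mulr_gt0 ?exprn_gt0// in kA.
by have := ler_wpM2l (ltW k0) kA; move: (expR B) => E; nra.
Unshelve. all: by end_near. Qed.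

Lemma lt_both_exists (x y : R) : 0 < x -> 0 < y ->
  exists z, [/\ 0 < z, z < x & z < y].
Proof.
move=> x0 y0; have [xy|yx] := leP x y.
  by exists (x / 2); split; lra.
by exists (y / 2); split; lra.
Qed.

(** Write [h] as [(h - c) + c]. The first term is controlled by
[Rintegral_exp_kernel_bound], and [c] is multiplied by the mass
[1 - exp (- k * (t - a))] of the kernel. *)
Lemma Rintegral_exp_kernel_cvg (a t c : R) (h : R -> R) :
  a < t -> mu.-integrable `]a, t[ (EFin \o h) ->
  (forall e, 0 < e -> \forall r \near 0^'+,
    \int[mu]_(x in `[t - r, t[) `|h x - c| <= e * r) ->
  k * \int[mu]_(x in `]a, t[) (h x * exp_kernel k t x)
    @[k --> +oo] --> c.
Proof.
have six (x : R) : x / 6 + (4 * (x / 6) + x / 6) = x by field.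
move=> at_ ih Hc; pose g x := `|h x - c|.
have ta0 : 0 < t - a by rewrite subr_gt0.
have ic : mu.-integrable `]a, t[ (EFin \o cst c).
  apply: measurable_bounded_integrable => //.
    by rewrite /= lebesgue_measure_itv/=; case: ifP => _;
      rewrite ?ltry -?EFinD ?ltry.
  exact: bounded_cst.
have ihc : mu.-integrable `]a, t[ (EFin \o (fun x => h x - c)).
  by apply: (integrableB _ ih ic).
have ig : mu.-integrable `]a, t[ (EFin \o g).
  exact: (integrable_norm ihc).
have sub_t : `]a, t[%classic `<=` [set x : R | x <= t].
  by move=> x /=; rewrite in_itv/= => /andP[_ /ltW].
set C := \int[mu]_(x in `]a, t[) g x.
have C0 : 0 <= C by apply: Rintegral_ge0 => x _; exact: normr_ge0.
apply/cvgrPdist_le => eps eps0.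
(* Four sixths for the blocks, one for the far part and one for the mass that
   the kernel lacks. *)
pose e : R := eps / 6.
have e0 : 0 < e by apply: divr_gt0.
have [d [d0 dta Hd]] : exists d, [/\ 0 < d, d < t - a & forall r, 0 <= r <= d ->
    \int[mu]_(x in `[t - r, t[) g x <= e * r].
  have [d /= d0 Hd] := Hc e e0.
  have [z [z0 zd zta]] := lt_both_exists d0 ta0.
  exists z; split=> // r /andP[]; rewrite le_eqVlt => /predU1P[<- _|r0 rz].
    by rewrite subr0 set_itvco0 Rintegral_set0 mulr0.
  by apply: Hd => //=; rewrite sub0r normrN gtr0_norm// (le_lt_trans rz).
near=> k.
have k0 : 0 < k by near: k; apply: nbhs_pinfty_gt; exact: num_real.
have k1 : 1 <= k by near: k; apply: nbhs_pinfty_ge; exact: num_real.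
have tail : k * expR (1 - k * d) * C <= e.
  by near: k; exact: near_expR_tail.
have mass : `|c| * expR (- k * (t - a)) <= e.
  have : k * expR (0 - k * (t - a)) * `|c| <= e.
    by near: k; exact: near_expR_tail.
  rewrite sub0r mulNr; apply: le_trans; rewrite mulrC -mulrA.
  by rewrite ler_peMl// mulr_ge0// expR_ge0.
have ihcE := integrableM_exp_kernel (measurable_itv _) (ltW k0) sub_t ihc.
have icE := integrableM_exp_kernel (measurable_itv _) (ltW k0) sub_t ic.
have bnd := Rintegral_exp_kernel_bound k0 (introT andP (conj d0 dta))
  (fun x => normr_ge0 (h x - c)) ig Hd.
have main : `|k * \int[mu]_(x in `]a, t[)
    ((h x - c) * exp_kernel k t x)| <= 4 * e + e.
  rewrite normrM gtr0_norm//.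
  have nI := @le_normr_Rintegral _ (measurableTypeR R) R
    mu `]a, t[%classic _ (measurable_itv _) ihcE.
  rewrite (le_trans (ler_wpM2l (ltW k0) nI))//.
  under eq_Rintegral do rewrite normrM [X in _ * X]ger0_norm ?exp_kernel_ge0//.
  by rewrite (le_trans bnd)// lerD2l.
have splitI : k * \int[mu]_(x in `]a, t[) (h x * exp_kernel k t x) =
   k * \int[mu]_(x in `]a, t[) ((h x - c) * exp_kernel k t x)
   + c * (1 - expR (- k * (t - a))).
  rewrite -(Rintegral_exp_kernel k at_).
  have -> : \int[mu]_(x in `]a, t[) (h x * exp_kernel k t x) =
    \int[mu]_(x in `]a, t[) ((h x - c) * exp_kernel k t x +
       c * exp_kernel k t x).
    by apply: eq_Rintegral => x _; rewrite -mulrDl subrK.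
  rewrite RintegralD// mulrDr; congr (_ + _).
  have iE : mu.-integrable `]a, t[ (EFin \o exp_kernel k t).
    have iE : mu.-integrable `[a, t] (EFin \o exp_kernel k t).
      apply: continuous_compact_integrable; first exact: segment_compact.
      apply: continuous_subspaceT; exact: C1_continuous (C1_exp_kernel k t).
    by apply: integrableS iE => //; exact: subset_itv_oo_cc.
  by rewrite !RintegralZl// mulrCA.
rewrite splitI mulrBr mulr1 opprD addrCA opprB [c + _]addrC subrK addrC.
rewrite (le_trans (ler_normB _ _))// normrM (ger0_norm (expR_ge0 _)).
by rewrite (le_trans (lerD mass main))// six.
Unshelve. all: by end_near. Qed.

(** * The limit of the Caputo-Fabrizio derivative *)

(** The half-interval is contained in the ball of radius [r], whose measure is
only twice as large, so a small mean over the ball gives a small mean over the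
half-interval. *)
Lemma lebesgue_pt_left (g : R -> R) (t : R) :
  measurable_fun setT g -> lebesgue_pt g t -> forall e, 0 < e ->
  \forall r \near 0^'+,
    \int[mu]_(x in `[t - r, t[) `|g x - g t| <= e * r.
Proof.
move=> mg /fine_cvgP[dfin /cvgrPdist_le dcvg] e e0.
have e20 : 0 < e / 2 by apply: divr_gt0.
near=> r.
have r0 : 0 < r by near: r; exact: nbhs_right_gt.
have fin : davg g t r \is a fin_num by near: r.
have dle : (davg g t r <= (e / 2)%:E)%E.
  rewrite -(fineK fin) lee_fin.
  have : `|0 - fine (davg g t r)| <= e / 2 by near: r; exact: dcvg.
  by rewrite sub0r normrN; apply: le_trans; exact: ler_norm.
have mh : measurable_fun setT (fun x => (`|g x - g t|)%:E).
  apply/measurable_EFinP; apply: measurableT_comp => //.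
  by apply: measurable_funB.
have Iball : (\int[mu]_(x in ball t r) (`|g x - g t|)%:E <= (e * r)%:E)%E.
  move: dle; rewrite /davg /iavg (lebesgue_measure_ball _ (ltW r0))//.
  rewrite inver mulrn_eq0/= gt_eqF// lee_pdivrMl ?mulrn_wgt0//.
  rewrite -EFinM => /le_trans; apply; rewrite lee_fin.
  by rewrite -(mulr_natr r 2) -mulrA [2 * _]mulrC divfK// mulrC.
have Ihalf : (\int[mu]_(x in `[(t - r)%R, t[) (`|g x - g t|)%:E
    <= (e * r)%:E)%E.
  rewrite -integral_itv_obnd_cbnd; last by exact: measurable_funTS.
  apply: le_trans Iball; apply: ge0_subset_integral => //.
  - exact: measurable_ball.
  - exact: measurable_funTS.
  - by rewrite ball_itv; apply: subset_itvl; rewrite bnd_simp lerDl ltW.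
rewrite /Rintegral -lee_fin fineK// ge0_fin_numE; last exact: integral_ge0.
exact: le_lt_trans Ihalf (ltry _).
Unshelve. all: by end_near. Qed.

Lemma cvg_rate_left1 :
  alpha / (1 - alpha) @[alpha --> (1 : R)^'-] --> +oo.
Proof.
apply/cvgryPge => A; near=> x.
have x1 : x < 1 by near: x; exact: nbhs_left_lt.
have A0 : 0 < 1 + `|A| by rewrite ltr_pwDl.
have : `|A| / (1 + `|A|) <= x.
  near: x; apply: nbhs_left_ge; by rewrite ltr_pdivrMr// mul1r ltrDr.
rewrite ler_pdivrMr// mulrDr mulr1 => h.
have A1 : A * (1 - x) <= `|A| * (1 - x).
  by rewrite ler_wpM2r ?ler_norm// subr_ge0 ltW.
rewrite ler_pdivlMr ?subr_gt0// (le_trans A1)//.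
by rewrite mulrBr mulr1 lerBlDr [_ * x]mulrC.
Unshelve. all: by end_near. Qed.

(** The function [h] replaces the representative that [caputo_fabrizio] uses; only
the integrals of the two against the kernel have to agree, which leaves the
choice of a well-behaved [h]. *)
Lemma caputo_fabrizio_cvg (a b t c : R) (f h : R -> R) :
  a < t -> mu.-integrable `]a, t[ (EFin \o h) ->
  (forall e, 0 < e -> \forall r \near 0^'+,
    \int[mu]_(x in `[t - r, t[) `|h x - c| <= e * r) ->
  (forall k,
    \int[mu]_(x in `]a, t[) (weak_derivative a b f x * exp_kernel k t x) =
    \int[mu]_(x in `]a, t[) (h x * exp_kernel k t x)) ->
  caputo_fabrizio a b alpha f t @[alpha --> 1^'-] --> c.
Proof.
move=> at_ ih Hc hE.
pose G k := k * \int[mu]_(x in `]a, t[) (h x * exp_kernel k t x).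
have cG : G (alpha / (1 - alpha)) @[alpha --> (1 : R)^'-] --> c.
  apply: (cvg_comp _ _ cvg_rate_left1); exact: Rintegral_exp_kernel_cvg.
have cV : alpha^-1 @[alpha --> (1 : R)^'-] --> (1 : R).
  rewrite -[X in _ --> X]invr1; apply: cvgV => //.
  exact: cvg_at_left_filter.
have : alpha^-1 * G (alpha / (1 - alpha)) @[alpha --> (1 : R)^'-] --> c.
  by rewrite -[X in _ --> X]mul1r; exact: cvgM.
apply: cvg_trans; apply: near_eq_cvg; near=> x.
have x0 : 0 < x by near: x; exact: nbhs_left_gt.
by rewrite /G -hE /caputo_fabrizio mulrA mulKf// gt_eqF.
Unshelve. all: by end_near. Qed.

End caputo_fabrizio_limit.

Theorem proposition5 (R : realType) (a b : R) (hab : a < b) :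
  (forall f : R -> R, W11 a b f ->
    {ae @lebesgue_measure R, forall t : R, t \in `]a, b[ ->
      caputo_fabrizio a b alpha f t @[alpha --> 1^'-]
        --> weak_derivative a b f t}) /\
  (forall f : R -> R, Ck_on 2 `[a, b] f ->
    forall t : R, t \in `]a, b] ->
      caputo_fabrizio a b alpha f t @[alpha --> 1^'-]
        --> derive_on `[a, b] f t).
Proof.
split=> [f [_ [g0 /weak_derivativeP[ig _]]]|f [df [ddf cddf]] t tab].
  set g := weak_derivative a b f in ig *.
  (* Lebesgue points are those of the extension of [g] by 0. *)
  have locG := integrable_locally (measurable_itv _) ig.
  have := lebesgue_differentiation locG.
  apply: filterS; first exact: (ae_filter_ringOfSetsType (@lebesgue_measure R)).
  move=> t Gt tab.
  have gGt : (g \_ `]a, b[) t = g t by rewrite patchE mem_set.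
  have gG x : x \in `]a, t[%classic -> (g \_ `]a, b[) x = g x.
    rewrite inE/= in_itv/= => /andP[ax xt]; rewrite patchE mem_set//=.
    by rewrite in_itv/= ax (lt_trans xt)// (itvP tab).
  rewrite -gGt; apply: (@caputo_fabrizio_cvg _ _ _ _ _ _ (g \_ `]a, b[)).
  - by rewrite (itvP tab).
  - have igt : (@lebesgue_measure R).-integrable `]a, t[ (EFin \o g).
      apply: integrableS ig => //; apply: subset_itvl.
      by rewrite bnd_simp ltW// (itvP tab).
    apply: eq_integrable igt => //.
    by move=> x xat; rewrite /= gG.
  - by apply: lebesgue_pt_left => //; case: locG.
  - by move=> k; apply: eq_Rintegral => x xat; rewrite gG.
have cdf := derivable_on_continuous ddf.
have wd := derive_on_is_weak_derivative hab (conj df cdf).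
have at_ : a < t by rewrite (itvP tab).
have tb : t <= b by rewrite (itvP tab).
have tcc : `[a, b]%classic t by rewrite /= in_itv/= ltW.
apply: (caputo_fabrizio_cvg (h := derive_on `[a, b] f)) => //.
- by apply: integrableS wd.1 => //; apply: subset_itvl; rewrite bnd_simp.
- move=> e e0; have := (subspace_continuousP _ _).1 cdf t tcc.
  move=> /cvgrPdist_le/(_ e e0); rewrite near_withinE => -[d /= d0 Hd].
  near=> r.
  have r0 : 0 < r by near: r; exact: nbhs_right_gt.
  have rd : r < d by near: r; exact: nbhs_right_lt.
  have rta : r <= t - a by near: r; apply: nbhs_right_le; rewrite subr_gt0.
  have sub_ab : `[t - r, t[%classic `<=` `[a, b]%classic.
    move=> x /=; rewrite !in_itv/= => /andP[trx xt].
    by rewrite (le_trans _ trx) ?lerBrDr -?lerBrDl//= ltW// (lt_le_trans xt).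
  have le_e x : x \in `[t - r, t[ ->
      `|derive_on `[a, b] f x - derive_on `[a, b] f t| <= e.
    move=> xr; rewrite distrC; apply: (Hd x); last exact: sub_ab.
    move: xr; rewrite in_itv/= => /andP[trx xt].
    by rewrite gtr0_norm ?subr_gt0// (le_lt_trans _ rd)// lerBlDr -lerBlDl.
  have cn : {within `[a, b], continuous
      (fun x => `|derive_on `[a, b] f x - derive_on `[a, b] f t|)}.
    move=> x; apply: cvg_norm; apply: cvgB; [exact: cdf|exact: cvg_cst].
  have ie : (@lebesgue_measure R).-integrable `[t - r, t[ (EFin \o cst e).
    apply: measurable_bounded_integrable => //; last exact: bounded_cst.
    by rewrite /= lebesgue_measure_itv/=; case: ifP => _; rewrite ?ltry.
  have -> : e * r = \int[@lebesgue_measure R]_(x in `[t - r, t[) e.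
    rewrite Rintegral_cst//= lebesgue_measure_itv/= lte_fin ltrBlDr ltrDl r0.
    by rewrite -EFinB/= opprB addrC subrK.
  apply: le_Rintegral => //.
  have icc := continuous_compact_integrable (@segment_compact _ a b) cn.
  by apply: integrableS icc.
- have atb : a < t <= b by rewrite at_.
  move=> k; exact: (is_weak_derivative_integral_eq atb (weak_derivativeP wd) wd
    (C1_exp_kernel k t)).
Unshelve. all: by end_near. Qed.
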